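(* Let $A$ and $B$ be isoclinic skew braces. Then $A$ is right nilpotent if and only if $B$ is right nilpotent.
   Context: A skew brace is a triple $(A,+,\circ)$ where $(A,+)$ and $(A,\circ)$ are groups (neither assumed commutative) with $a\circ(b+c)=a\circ b-a+a\circ c$ for all $a,b,c\in A$. The two groups share the identity $0$. Put $\lambda_a(b)=-a+a\circ b$, $a*b=-a+a\circ b-b$, $[a,b]_+=a+b-a-b$. The annihilator is $\operatorname{Ann}(A)=\ker\lambda\cap Z(A,+)\cap Z(A,\circ)$, an ideal of $A$, so that $A/\operatorname{Ann}(A)$ is a skew brace; $\overline{a}$ denotes the class of $a$. The commutator $A'$ of $A$ is the additive subgroup generated by all $[a,b]_+$ and all $a*b$, $a,b\in A$; it is an ideal of $A$ (in particular a sub skew brace). The values $[a,b]_+$ and $a*b$ depend only on the classes of $a,b$ modulo $\operatorname{Ann}(A)$. Skew braces $A$ and $B$ are isoclinic if there is an isoclinism $(\xi,\theta)$, i.e. skew brace isomorphisms $\xi\colon A/\operatorname{Ann}(A)\to B/\operatorname{Ann}(B)$ and $\theta\colon A'\to B'$ such that, whenever $a_1,a_2\in A$ and $b_1,b_2\in B$ satisfy $\xi(\overline{a_i})=\overline{b_i}$ for $i=1,2$, one has $\theta([a_1,a_2]_+)=[b_1,b_2]_+$ and $\theta(a_1*a_2)=b_1*b_2$. For subsets $X,Y\subseteq A$, $X*Y$ denotes the additive subgroup of $A$ generated by $\{x*y: x\in X, y\in Y\}$. Define $A^{(1)}=A$ and $A^{(k+1)}=A^{(k)}*A$ for $k\ge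 1$. $A$ is right nilpotent if $A^{(n)}=\{0\}$ for some $n\geq 1$. *)

(* Defs.v *)
From HB Require Import structures.
From mathcomp Require Import all_boot.
From mathcomp Require Import boolp classical_sets.

Set Implicit Arguments.
Unset Strict Implicit.
Unset Printing Implicit Defensive.

Local Open Scope classical_set_scope.
Local Open Scope quotient_scope.

Declare Scope brace_scope.
Delimit Scope brace_scope with B.
Local Open Scope brace_scope.

(* [groupType] provides the group (A, o). The library has no additive notation
   for non-commutative groups ([zmodType] is commutative), so the additive group
   is given by explicit operations and laws. That 0 is also the identity of
   (A, o) is derived (lemma [circ_one]). *)
HB.mixin Record isSkewBrace A of Group A := {
  sb_zero : A;
  sb_opp : A -> A;
  sb_add : A -> A -> A;
  sb_addA : associative sb_add;
  sb_add0 : left_id sb_zero sb_add;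
  sb_addr0 : right_id sb_zero sb_add;
  sb_addN : left_inverse sb_zero sb_opp sb_add;
  sb_addrN : right_inverse sb_zero sb_opp sb_add;
  sb_circD : forall a b c : A,
    (a * sb_add b c = sb_add (sb_add (a * b) (sb_opp a)) (a * c))%g
}.

#[short(type="skewBraceType")]
HB.structure Definition SkewBrace := {A of isSkewBrace A & Group A}.

Notation "0" := (@sb_zero _) : brace_scope.
Notation "- a" := (sb_opp a) : brace_scope.
Notation "a + b" := (sb_add a b) : brace_scope.
Notation "a - b" := (sb_add a (sb_opp b)) : brace_scope.
Notation "a ∘ b" := (a * b)%g (at level 40, left associativity) : brace_scope.

Definition lambda (A : skewBraceType) (a b : A) : A := - a + a ∘ b.
Definition star (A : skewBraceType) (a b : A) : A := - a + a ∘ b - b.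
Definition add_comm (A : skewBraceType) (a b : A) : A := a + b - a - b.

Definition add_subgroup (A : skewBraceType) (S : set A) : Prop :=
  [/\ S 0, (forall x y, S x -> S y -> S (x + y)) & (forall x, S x -> S (- x))].

Definition add_generated (A : skewBraceType) (S : set A) : set A :=
  smallest (@add_subgroup A) S.

Definition ker_lambda (A : skewBraceType) : set A :=
  [set a | forall b, lambda a b = b].
Definition add_center (A : skewBraceType) : set A :=
  [set a | forall b, a + b = b + a].
Definition circ_center (A : skewBraceType) : set A :=
  [set a | forall b, a ∘ b = b ∘ a].
Definition annihilator (A : skewBraceType) : set A :=
  @ker_lambda A `&` @add_center A `&` @circ_center A.

Definition commutator (A : skewBraceType) : set A :=
  add_generated ([set add_comm a b | a in setT & b in setT] `|`
                 [set star a b | a in setT & b in setT]).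

Definition set_star (A : skewBraceType) (X Y : set A) : set A :=
  add_generated [set star x y | x in X & y in Y].

(* Indexed so that [right_series A n] is A^(n) for n >= 1 (the value at 0 is
   irrelevant). *)
Definition right_series (A : skewBraceType) (n : nat) : set A :=
  iter n.-1 (fun X => set_star X setT) setT.

Definition right_nilpotent (A : skewBraceType) : Prop :=
  exists2 n : nat, (0 < n)%N & @right_series A n = [set 0].

Section Elementary.
Variable A : skewBraceType.
Implicit Types a b c : A.

Lemma sb_addKl a b : - a + (a + b) = b.
Proof. by rewrite sb_addA sb_addN sb_add0. Qed.

Lemma sb_addNKl a b : a + (- a + b) = b.
Proof. by rewrite sb_addA sb_addrN sb_add0. Qed.

Lemma sb_addKr a b : a + b - b = a.
Proof. by rewrite -sb_addA sb_addrN sb_addr0. Qed.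

Lemma sb_addNKr a b : a - b + b = a.
Proof. by rewrite -sb_addA sb_addN sb_addr0. Qed.

Lemma sb_addIl a b c : a + b = a + c -> b = c.
Proof. by move=> e; rewrite -(sb_addKl a b) e sb_addKl. Qed.

Lemma sb_oppK a : - - a = a.
Proof. by apply: (@sb_addIl (- a)); rewrite sb_addrN sb_addN. Qed.

Lemma sb_oppD a b : - (a + b) = - b - a.
Proof.
by apply: (@sb_addIl (a + b)); rewrite sb_addrN -sb_addA sb_addNKl sb_addrN.
Qed.

Lemma sb_subr0_eq a b : a - b = 0 -> a = b.
Proof. by move=> e; rewrite -(sb_addNKr a b) e sb_add0. Qed.

Lemma circ_zero a : a ∘ 0 = a.
Proof.
have := sb_circD a 0 0; rewrite sb_add0 -sb_addA => e.
have {}e : a ∘ 0 + (- a + a ∘ 0) = a ∘ 0 + 0 by rewrite sb_addr0 -e.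
by rewrite -(sb_addNKl a (a ∘ 0)) (sb_addIl e) sb_addr0.
Qed.

Lemma circ_one : 1%g = 0 :> A.
Proof. by rewrite -(circ_zero 1%g) mul1g. Qed.

Lemma circ_lambda a b : a ∘ b = a + lambda a b.
Proof. by rewrite /lambda sb_addNKl. Qed.

Lemma lambda_star a b : lambda a b = star a b + b.
Proof. by rewrite /star sb_addNKr. Qed.

Lemma annP a : annihilator a <->
  forall b, [/\ a ∘ b = a + b, b ∘ a = a + b & b + a = a + b].
Proof.
split=> [[[ka za] ca] b|h].
- by split; rewrite -?ca -?za // -(ka b) circ_lambda ka.
- split; [split|] => b; have [e1 e2 e3] := h b.
  + by rewrite /lambda e1 sb_addKl.
  + by rewrite e3.
  + by rewrite e1 e2.
Qed.

Lemma ann0 : annihilator (0 : A).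
Proof.
apply/annP => b; split; rewrite ?sb_add0 ?sb_addr0 ?circ_zero //.
by rewrite -circ_one mul1g.
Qed.

Lemma annD a b : annihilator a -> annihilator b -> annihilator (a + b).
Proof.
move=> /annP ha /annP hb; apply/annP => c; have [ab _ _] := ha b.
split.
- by rewrite -ab -mulgA; case: (hb c) => -> _ _; case: (ha (b + c)) => -> _ _;
    rewrite sb_addA ab.
- rewrite -ab mulgA; case: (ha c) => _ -> _; case: (hb (a + c)) => _ -> _.
  by rewrite sb_addA; case: (ha b) => _ _ ->; rewrite ab.
- rewrite sb_addA; case: (ha c) => _ _ ->; rewrite -!sb_addA.
  by case: (hb c) => _ _ ->.
Qed.

Lemma annN a : annihilator a -> annihilator (- a).
Proof.
move=> /annP ha.
have aN : a^-1%g = - a.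
  apply: (mulgI a); rewrite mulgV circ_one.
  by case: (ha (- a)) => -> _ _; rewrite sb_addrN.
apply/annP => c; rewrite -aN; split.
- apply: (mulgI a); rewrite mulVKg; case: (ha (a^-1%g + c)) => -> _ _.
  by rewrite aN sb_addNKl.
- apply: (mulIg a); rewrite mulgVK; case: (ha (a^-1%g + c)) => _ -> _.
  by rewrite aN sb_addNKl.
- apply: (@sb_addIl a); rewrite aN sb_addNKl sb_addA.
  by case: (ha c) => _ _ <-; rewrite sb_addKr.
Qed.

End Elementary.

(* Congruence modulo Ann(A): a and b have the same class when -a + b lies in
   Ann(A). As Ann(A) is an ideal, its left and right cosets for + and for o
   all coincide. *)
Definition ann_rel (A : skewBraceType) (a b : A) : bool :=
  `[< annihilator (- a + b) >].

Section AnnQuotient.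
Variable A : skewBraceType.
Implicit Types a b c : A.

Lemma ann_relP a b : reflect (exists2 z, annihilator z & b = z + a) (ann_rel a b).
Proof.
apply: (iffP (asboolP _)) => [h|[z hz ->]].
- exists (- a + b) => //; have /annP/(_ a)[_ _ <-] := h.
  by rewrite sb_addNKl.
- by have /annP/(_ a)[_ _ <-] := hz; rewrite sb_addKl.
Qed.

Lemma ann_rel_refl : reflexive (@ann_rel A).
Proof. by move=> a; apply/ann_relP; exists 0; [exact: ann0|rewrite sb_add0]. Qed.

Lemma ann_rel_sym : symmetric (@ann_rel A).
Proof.
suff h a b : ann_rel a b -> ann_rel b a by move=> a b; apply/idP/idP; apply: h.
move=> /ann_relP[z hz ->]; apply/ann_relP; exists (- z); first exact: annN.
by rewrite sb_addKl.
Qed.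

Lemma ann_rel_trans : transitive (@ann_rel A).
Proof.
move=> b a c /ann_relP[z hz ->] /ann_relP[w hw ->]; apply/ann_relP.
by exists (w + z); [exact: annD|rewrite sb_addA].
Qed.

Canonical ann_equiv : equiv_rel A :=
  EquivRel (@ann_rel A) ann_rel_refl ann_rel_sym ann_rel_trans.

Lemma ann_rel_add a a' b b' :
  ann_rel a a' -> ann_rel b b' -> ann_rel (a + b) (a' + b').
Proof.
move=> /ann_relP[z hz ->] /ann_relP[w hw ->]; apply/ann_relP.
exists (z + w); first exact: annD.
rewrite -!sb_addA; congr (_ + _); rewrite !sb_addA.
by have /annP/(_ a)[_ _ ->] := hw.
Qed.

Lemma ann_rel_opp a a' : ann_rel a a' -> ann_rel (- a) (- a').
Proof.
move=> /ann_relP[z hz ->]; apply/ann_relP; exists (- z); first exact: annN.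
by have /annP/(_ (- a))[_ _ <-] := annN hz; rewrite sb_oppD.
Qed.

Lemma ann_rel_circ a a' b b' :
  ann_rel a a' -> ann_rel b b' -> ann_rel (a ∘ b) (a' ∘ b').
Proof.
move=> /ann_relP[z hz ->] /ann_relP[w hw ->]; apply/ann_relP.
exists (z + w); first exact: annD.
have /annP/(_ (a ∘ b))[<- _ _] := annD hz hw.
have /annP hz' := hz; have /annP hw' := hw.
have [<- _ _] := hz' a; have [<- _ _] := hw' b; have [<- _ _] := hz' w.
rewrite -!mulgA; congr (_ * _)%g; rewrite !mulgA; congr (_ * _)%g.
by have [-> -> _] := hw' a.
Qed.

Lemma ann_rel_inv a a' : ann_rel a a' -> ann_rel (a^-1)%g (a'^-1)%g.
Proof.
move=> /ann_relP[z hz ->]; apply/ann_relP; exists (- z); first exact: annN.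
have /annP/(_ (a^-1)%g)[_ <- _] := annN hz.
apply: (mulgI (z + a)); rewrite mulgV.
have /annP/(_ a)[<- _ _] := hz.
have /annP/(_ (- z))[e _ _] := hz.
by rewrite mulgA mulgK e sb_addrN circ_one.
Qed.

End AnnQuotient.

Definition annQuot (A : skewBraceType) : Type := {eq_quot (@ann_rel A)}.

HB.instance Definition _ (A : skewBraceType) := Choice.on (annQuot A).
HB.instance Definition _ (A : skewBraceType) := Quotient.on (annQuot A).
HB.instance Definition _ (A : skewBraceType) := EqQuotient.on (annQuot A).

Definition ann_class (A : skewBraceType) (a : A) : annQuot A := \pi_(annQuot A) a.

Section AnnQuotientBrace.
Variable A : skewBraceType.
Implicit Types (a b : A) (x y z : annQuot A).

Definition annq_add x y : annQuot A := ann_class (repr x + repr y).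
Definition annq_opp x : annQuot A := ann_class (- repr x).
Definition annq_circ x y : annQuot A := ann_class (repr x ∘ repr y).
Definition annq_inv x : annQuot A := ann_class (repr x)^-1%g.

Lemma ann_classP a b : ann_class a = ann_class b <-> ann_rel a b.
Proof. by split=> [/eqquotP|h]; [|apply/eqquotP]. Qed.

Lemma ann_class_surj x : exists a, x = ann_class a.
Proof. by exists (repr x); rewrite /ann_class reprK. Qed.

Lemma repr_ann_class a : ann_rel (repr (ann_class a)) a.
Proof. by apply/ann_classP; rewrite /ann_class reprK. Qed.

Lemma annq_addE a b : annq_add (ann_class a) (ann_class b) = ann_class (a + b).
Proof. by apply/ann_classP/ann_rel_add; exact: repr_ann_class. Qed.

Lemma annq_oppE a : annq_opp (ann_class a) = ann_class (- a).
Proof. by apply/ann_classP/ann_rel_opp/repr_ann_class. Qed.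

Lemma annq_circE a b : annq_circ (ann_class a) (ann_class b) = ann_class (a ∘ b).
Proof. by apply/ann_classP/ann_rel_circ; exact: repr_ann_class. Qed.

Lemma annq_invE a : annq_inv (ann_class a) = ann_class (a^-1)%g.
Proof. by apply/ann_classP/ann_rel_inv/repr_ann_class. Qed.

Let annqE := (annq_addE, annq_oppE, annq_circE, annq_invE).

Lemma annq_circA : associative annq_circ.
Proof.
move=> x y z; case: (ann_class_surj x) (ann_class_surj y) (ann_class_surj z).
by move=> a -> [b ->] [c ->]; rewrite !annqE mulgA.
Qed.

Lemma annq_circ1 : left_id (ann_class 1%g) annq_circ.
Proof. by move=> x; case: (ann_class_surj x) => a ->; rewrite !annqE mul1g. Qed.

Lemma annq_circr1 : right_id (ann_class 1%g) annq_circ.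
Proof. by move=> x; case: (ann_class_surj x) => a ->; rewrite !annqE mulg1. Qed.

Lemma annq_circV : left_inverse (ann_class 1%g) annq_inv annq_circ.
Proof. by move=> x; case: (ann_class_surj x) => a ->; rewrite !annqE mulVg. Qed.

Lemma annq_circrV : right_inverse (ann_class 1%g) annq_inv annq_circ.
Proof. by move=> x; case: (ann_class_surj x) => a ->; rewrite !annqE mulgV. Qed.

HB.instance Definition _ := isGroup.Build (annQuot A)
  annq_circA annq_circ1 annq_circr1 annq_circV annq_circrV.

Lemma annq_addA : associative annq_add.
Proof.
move=> x y z; case: (ann_class_surj x) (ann_class_surj y) (ann_class_surj z).
by move=> a -> [b ->] [c ->]; rewrite !annqE sb_addA.
Qed.

Lemma annq_add0 : left_id (ann_class 0) annq_add.
Proof. by move=> x; case: (ann_class_surj x) => a ->; rewrite !annqE sb_add0. Qed.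

Lemma annq_addr0 : right_id (ann_class 0) annq_add.
Proof. by move=> x; case: (ann_class_surj x) => a ->; rewrite !annqE sb_addr0. Qed.

Lemma annq_addN : left_inverse (ann_class 0) annq_opp annq_add.
Proof. by move=> x; case: (ann_class_surj x) => a ->; rewrite !annqE sb_addN. Qed.

Lemma annq_addrN : right_inverse (ann_class 0) annq_opp annq_add.
Proof. by move=> x; case: (ann_class_surj x) => a ->; rewrite !annqE sb_addrN. Qed.

Lemma annq_circD x y z :
  (x * annq_add y z)%g = annq_add (annq_add (x * y)%g (annq_opp x)) (x * z)%g.
Proof.
rewrite -[LHS]/(annq_circ _ _) -[(x * y)%g]/(annq_circ _ _).
rewrite -[(x * z)%g]/(annq_circ _ _).
case: (ann_class_surj x) (ann_class_surj y) (ann_class_surj z).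
by move=> a -> [b ->] [c ->]; rewrite !annqE sb_circD.
Qed.

HB.instance Definition _ := isSkewBrace.Build (annQuot A)
  annq_addA annq_add0 annq_addr0 annq_addN annq_addrN annq_circD.

End AnnQuotientBrace.

Section Commutator.
Variable A : skewBraceType.
Implicit Types a b : A.

Lemma commutator_sub : add_subgroup (@commutator A).
Proof.
split=> [S [[]] //|x y hx hy S hS|x hx S hS].
- by have [[_ h _] _] := hS; apply: h; [exact: hx|exact: hy].
- by have [[_ _ h] _] := hS; apply: h; exact: hx.
Qed.

Lemma commutator_comm a b : commutator (add_comm a b).
Proof. by apply: sub_gen_smallest; left; exists a => //; exists b. Qed.

Lemma commutator_star a b : commutator (star a b).
Proof. by apply: sub_gen_smallest; right; exists a => //; exists b. Qed.

Lemma commutator0 : commutator (0 : A).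
Proof. by have [] := commutator_sub. Qed.

Lemma commutatorD a b : commutator a -> commutator b -> commutator (a + b).
Proof. by have [_ h _] := commutator_sub; exact: h. Qed.

Lemma commutatorN a : commutator a -> commutator (- a).
Proof. by have [_ _ h] := commutator_sub; exact: h. Qed.

Lemma commutator_lambda a b : commutator b -> commutator (lambda a b).
Proof.
by move=> hb; rewrite lambda_star; apply: commutatorD => //; exact: commutator_star.
Qed.

Lemma commutatorM a b : commutator a -> commutator b -> commutator (a ∘ b).
Proof.
by move=> ha hb; rewrite circ_lambda; apply: commutatorD => //; exact: commutator_lambda.
Qed.

Lemma commutator1 : commutator (1%g : A).
Proof. by rewrite circ_one; exact: commutator0. Qed.

Lemma commutatorV a : commutator a -> commutator (a^-1)%g.
Proof.
move=> ha; have := circ_lambda (a^-1)%g a; rewrite mulVg circ_one => e.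
have -> : (a^-1)%g = - lambda (a^-1)%g a.
  by apply: sb_subr0_eq; rewrite sb_oppK.
by apply: commutatorN; exact: commutator_lambda.
Qed.

End Commutator.

Definition commSub (A : skewBraceType) : Type := set_type (@commutator A).

HB.instance Definition _ (A : skewBraceType) := Choice.on (commSub A).
HB.instance Definition _ (A : skewBraceType) := SubType.on (commSub A).

Section CommutatorBrace.
Variable A : skewBraceType.
Implicit Types x y z : commSub A.

Definition comm_in (a : A) (h : commutator a) : commSub A := exist _ a (mem_set h).

Lemma comm_valP x : commutator (val x).
Proof. exact: set_mem (valP x). Qed.

Definition comm_circ x y := comm_in (commutatorM (comm_valP x) (comm_valP y)).
Definition comm_one : commSub A := comm_in (@commutator1 A).
Definition comm_inv x := comm_in (commutatorV (comm_valP x)).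
Definition comm_add x y := comm_in (commutatorD (comm_valP x) (comm_valP y)).
Definition comm_zero : commSub A := comm_in (@commutator0 A).
Definition comm_opp x := comm_in (commutatorN (comm_valP x)).

Lemma comm_circA : associative comm_circ.
Proof. by move=> x y z; apply: val_inj; rewrite /= mulgA. Qed.
Lemma comm_circ1 : left_id comm_one comm_circ.
Proof. by move=> x; apply: val_inj; rewrite /= mul1g. Qed.
Lemma comm_circr1 : right_id comm_one comm_circ.
Proof. by move=> x; apply: val_inj; rewrite /= mulg1. Qed.
Lemma comm_circV : left_inverse comm_one comm_inv comm_circ.
Proof. by move=> x; apply: val_inj; rewrite /= mulVg. Qed.
Lemma comm_circrV : right_inverse comm_one comm_inv comm_circ.
Proof. by move=> x; apply: val_inj; rewrite /= mulgV. Qed.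

HB.instance Definition _ := isGroup.Build (commSub A)
  comm_circA comm_circ1 comm_circr1 comm_circV comm_circrV.

Lemma comm_addA : associative comm_add.
Proof. by move=> x y z; apply: val_inj; rewrite /= sb_addA. Qed.
Lemma comm_add0 : left_id comm_zero comm_add.
Proof. by move=> x; apply: val_inj; rewrite /= sb_add0. Qed.
Lemma comm_addr0 : right_id comm_zero comm_add.
Proof. by move=> x; apply: val_inj; rewrite /= sb_addr0. Qed.
Lemma comm_addN : left_inverse comm_zero comm_opp comm_add.
Proof. by move=> x; apply: val_inj; rewrite /= sb_addN. Qed.
Lemma comm_addrN : right_inverse comm_zero comm_opp comm_add.
Proof. by move=> x; apply: val_inj; rewrite /= sb_addrN. Qed.
Lemma comm_circD x y z :
  (x * comm_add y z)%g = comm_add (comm_add (x * y)%g (comm_opp x)) (x * z)%g.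
Proof. by apply: val_inj; rewrite /= sb_circD. Qed.

HB.instance Definition _ := isSkewBrace.Build (commSub A)
  comm_addA comm_add0 comm_addr0 comm_addN comm_addrN comm_circD.

End CommutatorBrace.

Definition comm_bracket (A : skewBraceType) (a b : A) : commSub A :=
  comm_in (commutator_comm a b).
Definition comm_star (A : skewBraceType) (a b : A) : commSub A :=
  comm_in (commutator_star a b).

Definition skew_brace_iso (A B : skewBraceType) (f : A -> B) : Prop :=
  [/\ bijective f, {morph f : a b / a + b} & {morph f : a b / a ∘ b}].

Definition isoclinism (A B : skewBraceType)
    (xi : annQuot A -> annQuot B) (theta : commSub A -> commSub B) : Prop :=
  [/\ skew_brace_iso xi, skew_brace_iso theta &
      forall (a1 a2 : A) (b1 b2 : B),
        xi (ann_class a1) = ann_class b1 -> xi (ann_class a2) = ann_class b2 ->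
        theta (comm_bracket a1 a2) = comm_bracket b1 b2 /\
        theta (comm_star a1 a2) = comm_star b1 b2].

Definition isoclinic (A B : skewBraceType) : Prop :=
  exists (xi : annQuot A -> annQuot B) (theta : commSub A -> commSub B),
    isoclinism xi theta.

(* Main.v *)
From mathcomp Require Import all_boot.
From mathcomp Require Import boolp classical_sets.
Require Import Defs.

(* Right nilpotency passes to images under surjective morphisms, and it lifts
   from A/Ann(A) to A: if the n-th term of the right series of A/Ann(A)
   vanishes, then A^(n) lies in Ann(A), so A^(n+1) = A^(n) * A = 0. Hence it
   only depends on the isomorphism class of A/Ann(A), which isoclinism
   preserves. *)

Set Implicit Arguments.
Unset Strict Implicit.
Unset Printing Implicit Defensive.

Local Open Scope classical_set_scope.
Local Open Scope brace_scope.

Section AddGenerated.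
Variable A : skewBraceType.

Lemma add_generated_sub (S T : set A) :
  add_subgroup T -> S `<=` T -> add_generated S `<=` T.
Proof. by move=> hT ST x; apply. Qed.

Lemma add_generated_group (S : set A) : add_subgroup (add_generated S).
Proof.
split=> [T [[]] //|x y hx hy T hT|x hx T hT].
- by have [[_ h _] _] := hT; apply: h; [exact: hx|exact: hy].
- by have [[_ _ h] _] := hT; apply: h; exact: hx.
Qed.

End AddGenerated.

Section Morphism.
Variables (A B : skewBraceType) (f : A -> B).
Hypothesis fD : {morph f : a b / a + b}.

Lemma brace_morph0 : f 0 = 0.
Proof. by apply: (@sb_addIl _ (f 0)); rewrite -fD !sb_addr0. Qed.

Lemma brace_morphN : {morph f : a / - a}.
Proof.
by move=> a; apply: (@sb_addIl _ (f a)); rewrite -fD !sb_addrN brace_morph0.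
Qed.

(** Both inclusions come from minimality of the generated subgroup: additive morphisms carry
    subgroups to subgroups by image and by preimage. *)
Lemma add_generated_image (S : set A) :
  add_generated (f @` S) = f @` add_generated S.
Proof.
have [g0 gD gN] := add_generated_group S.
have [h0 hD hN] := add_generated_group (f @` S).
apply/seteqP; split.
- apply: add_generated_sub => [|_ [x Sx <-]]; last first.
    by exists x => //; apply: sub_gen_smallest.
  split=> [|_ _ [x hx <-] [y hy <-]|_ [x hx <-]].
  + by exists 0 => //; rewrite brace_morph0.
  + by exists (x + y); rewrite ?fD //; apply: gD.
  + by exists (- x); rewrite ?brace_morphN //; apply: gN.
- move=> _ [x hx <-].
  apply: (@add_generated_sub _ S (f @^-1` add_generated (f @` S))) hx.
    split=> [|a b|a] /=.
    + by rewrite brace_morph0.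
    + by rewrite fD; apply: hD.
    + by rewrite brace_morphN; apply: hN.
  by move=> a Sa; apply: sub_gen_smallest; exists a.
Qed.

Hypothesis fM : {morph f : a b / a ∘ b}.

Lemma star_morph : {morph f : a b / star a b}.
Proof. by move=> a b; rewrite /star !fD !brace_morphN fM. Qed.

Hypothesis f_surj : forall y, exists x, f x = y.

(** Induction on the number of star products. Surjectivity gives the base case and lifts the
    right-hand factors, which range over all of [B]. *)
Lemma right_series_image n : f @` @right_series A n = @right_series B n.
Proof.
rewrite /right_series; elim: n.-1 => [|k /= <-].
  by apply/seteqP; split=> // y _; have [x <-] := f_surj y; exists x.
rewrite /set_star -add_generated_image; congr add_generated.
apply/seteqP; split=> [_ [_ [x hx [y _ <-]] <-]|_ [_ [x hx <-] [y _ <-]]].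
  by exists (f x); [exists x|exists (f y) => //; rewrite star_morph].
have [z <-] := f_surj y; exists (star x z); last exact: star_morph.
by exists x => //; exists z.
Qed.

Lemma right_nilpotent_image : right_nilpotent A -> right_nilpotent B.
Proof.
move=> [n n_gt0 An]; exists n => //.
by rewrite -right_series_image An image_set1 brace_morph0.
Qed.

End Morphism.

Section AnnihilatorQuotient.
Variable A : skewBraceType.

Lemma ann_classD : {morph @ann_class A : a b / a + b}.
Proof. by move=> a b; rewrite -annq_addE. Qed.

Lemma ann_classM : {morph @ann_class A : a b / a ∘ b}.
Proof. by move=> a b; rewrite -annq_circE. Qed.

Lemma ann_class_preim (y : annQuot A) : exists x, ann_class x = y.
Proof. by have [x ->] := ann_class_surj y; exists x. Qed.

Lemma ann_class_eq0 (a : A) : ann_class a = 0 -> annihilator a.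
Proof.
move=> /esym/ann_classP/ann_relP[z hz ->].
by rewrite sb_addr0.
Qed.

Lemma star_ann (a b : A) : annihilator a -> star a b = 0.
Proof. by move=> /annP/(_ b)[e _ _]; rewrite /star e sb_addKl sb_addrN. Qed.

Lemma right_nilpotent_annQuot : right_nilpotent (annQuot A) <-> right_nilpotent A.
Proof.
split; last exact: (right_nilpotent_image ann_classD ann_classM ann_class_preim).
move=> [n n_gt0]; rewrite -(right_series_image ann_classD ann_classM ann_class_preim).
move=> Qn; exists n.+1 => //.
(* Positivity of [n] matters: the truncated predecessor makes the terms at 0 and 1 both equal to
   [setT], so this recursion starts at 1. *)
have -> : @right_series A n.+1 = set_star (@right_series A n) setT.
  by rewrite /right_series; case: n n_gt0 {Qn}.
apply/seteqP; split=> [|_ ->]; last first.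
  by have [] := add_generated_group [set star x y | x in @right_series A n & y in setT].
(* Since {0} is an additive subgroup, it suffices to kill the generators [star x y] with [x] in the
   [n]-th term. *)
apply: add_generated_sub => [|_ [x hx [y _ <-]]].
  by split=> [//|_ _ -> ->|_ ->] /=; rewrite ?sb_add0 // -[LHS]sb_add0 sb_addrN.
apply/star_ann/ann_class_eq0.
(* The class of [x] lies in the [n]-th term of the series of the quotient, which is {0} by [Qn]. *)
have : (@ann_class A @` right_series n) (ann_class x) by exists x.
by rewrite Qn.
Qed.

End AnnihilatorQuotient.

Theorem theorem3p4 (A B : skewBraceType) (hAB : isoclinic A B) :
  right_nilpotent A <-> right_nilpotent B.
Proof.
have [xi [_ [[[g xiK gK] xiD xiM] _ _]]] := hAB.
(* The inverse [g] of [xi] is also a morphism, so the image lemma applies in both directions. *)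
have gD : {morph g : a b / a + b}.
  by move=> a b; apply: (can_inj xiK); rewrite xiD !gK.
have gM : {morph g : a b / a ∘ b}.
  by move=> a b; apply: (can_inj xiK); rewrite xiM !gK.
rewrite -(right_nilpotent_annQuot A) -(right_nilpotent_annQuot B); split.
  by apply: (right_nilpotent_image xiD xiM) => y; exists (g y).
by apply: (right_nilpotent_image gD gM) => y; exists (xi y).
Qed.
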